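(* Let $R$ be a ring. Then every pure-projective left $R$-module is semi-compact if and only if $R$ is left Noetherian.
   Context: Rings are associative with identity and modules are unitary. For a left $R$-module $M$ and a left ideal $I$ of $R$, $M[I]=\{m\in M\mid Im=0\}$. $M$ is semi-compact if every set of congruences $x\equiv x_\alpha\pmod{M[I_\alpha]}$ ($\alpha\in\Lambda$, $x_\alpha\in M$, $I_\alpha$ a left ideal of $R$), each finite subset of which has a common solution in $M$, has a simultaneous solution in $M$. A short exact sequence of left modules is pure if every finitely presented left module is projective relative to it; a left module is pure-projective if it is projective relative to every pure exact sequence. *)

(* Defs.v *)
From HB Require Import structures.
From mathcomp Require Import all_boot all_order all_algebra.
From mathcomp Require Import all_classical.

Set Implicit Arguments.
Unset Strict Implicit.
Unset Printing Implicit Defensive.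

Import GRing.Theory.
Local Open Scope classical_set_scope.
Local Open Scope ring_scope.

(* [idealr_closed] of the library is not used since it excludes the unit
   ideal. Closure under opposites follows from [r := -1]. *)
Definition left_ideal (R : pzRingType) (I : set R) : Prop :=
  [/\ I 0,
      forall x y, I x -> I y -> I (x + y) &
      forall r x, I x -> I (r * x)].

Definition left_noetherian (R : pzRingType) : Prop :=
  forall I : nat -> set R,
    (forall n, left_ideal (I n)) ->
    (forall n, I n `<=` I n.+1) ->
    exists N, forall n, (N <= n)%N -> I n = I N.

(* M[I] = {m | Im = 0} *)
Definition annihilated (R : pzRingType) (M : lmodType R) (I : set R) : set M :=
  [set m | forall r, I r -> r *: m = 0].
Arguments annihilated {R} M I.

Definition semi_compact (R : pzRingType) (M : lmodType R) : Prop :=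
  forall (L : Type) (x : L -> M) (I : L -> set R),
    (forall a, left_ideal (I a)) ->
    (forall F : set L, finite_set F ->
       exists m : M, forall a, F a -> annihilated M (I a) (m - x a)) ->
    exists m : M, forall a, annihilated M (I a) (m - x a).

(* 0 -> A -f-> B -g-> C -> 0 *)
Definition short_exact (R : pzRingType) (A B C : lmodType R)
    (f : {linear A -> B}) (g : {linear B -> C}) : Prop :=
  [/\ injective f, range f = [set b | g b = 0] & range g = setT].

(* Projectivity of P relative to a sequence ending in g : B -> C. *)
Definition projective_rel (R : pzRingType) (P B C : lmodType R)
    (g : {linear B -> C}) : Prop :=
  forall h : {linear P -> C}, exists k : {linear P -> B}, forall p, g (k p) = h p.

(* Existence of an exact sequence R^m -> R^n -> F -> 0. *)
Definition finitely_presented (R : pzRingType) (F : lmodType R) : Prop :=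
  exists (m n : nat) (q : {linear 'rV[R]_m -> 'rV[R]_n})
         (p : {linear 'rV[R]_n -> F}),
    range q = [set v | p v = 0] /\ range p = setT.

Definition pure_exact (R : pzRingType) (A B C : lmodType R)
    (f : {linear A -> B}) (g : {linear B -> C}) : Prop :=
  short_exact f g /\
  forall F : lmodType R, finitely_presented F -> projective_rel F g.

Definition pure_projective (R : pzRingType) (P : lmodType R) : Prop :=
  forall (A B C : lmodType R) (f : {linear A -> B}) (g : {linear B -> C}),
    pure_exact f g -> projective_rel P g.

(* Main.v *)
Require Import Defs.
From HB Require Import structures.
From mathcomp Require Import all_boot all_order all_algebra.
From mathcomp Require Import all_classical.

Set Implicit Arguments.
Unset Strict Implicit.
Unset Printing Implicit Defensive.

Import GRing.Theory.
Local Open Scope classical_set_scope.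
Local Open Scope ring_scope.

(** Over a left Noetherian ring every module is semi-compact: finitely many of
    the ideals of a system of congruences already generate a left ideal
    containing all the others ([noetherian_finite_subfamily]), and a solution of
    the corresponding finite subsystem solves everything
    ([noetherian_semi_compact]).

    For the converse, let [a] be a sequence in R. The modules
    R/(R a_0 + ... + R a_(n-1)) are finitely presented, so their direct sum is
    pure-projective ([dsum_pure_projective]), hence semi-compact. Let [e n] be
    the class of 1 in the [n]-th summand. The infinite vector (e 0, e 1, ...) is
    not in the direct sum. As the annihilators of the [e n] increase with [n],
    it differs from its [n]-th truncation by a vector killed by the annihilator
    of [e n]; the same holds of any later truncation, so each finite set of
    these congruences is solvable. Semi-compactness then provides a vector of
    finite support that satisfies all of them, which is possible only if the
    annihilators are stationary
    ([dsum_semi_compact_stationary]). The annihilator of [e n] being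
    R a_0 + ... + R a_(n-1), some [a n] is a combination of its
    predecessors, and the ascending chain condition follows
    ([left_noetherian_seq]). *)

(** * Modules over a left Noetherian ring *)

Section GeneratedIdeal.
Variable R : pzRingType.
Implicit Types (A B : set R).

(** The intersection form makes it immediate that a left ideal containing [A],
    such as the annihilator of an element killed by [A], contains the left
    ideal generated by [A]. *)
Definition ideal_gen A : set R :=
  [set r | forall K, left_ideal K -> A `<=` K -> K r].

Lemma sub_ideal_gen A : A `<=` ideal_gen A.
Proof. by move=> r Ar K _; apply. Qed.

Lemma ideal_genS A B : A `<=` B -> ideal_gen A `<=` ideal_gen B.
Proof. by move=> AB r Ar K Kid BK; apply: Ar => // s /AB /BK. Qed.

Lemma ideal_gen_left_ideal A : left_ideal (ideal_gen A).
Proof.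
split=> [K [] //|x y Ax Ay K Kid AK|r x Ax K Kid AK].
- by have [_ KD _] := Kid; apply: KD; [exact: Ax|exact: Ay].
- by have [_ _ KM] := Kid; apply: KM; exact: Ax.
Qed.

Lemma annihilator_left_ideal (M : lmodType R) (m : M) :
  left_ideal [set r | r *: m = 0].
Proof.
split=> [|x y /= xm ym|r x /= xm]; first exact: scale0r.
- by rewrite scalerDl xm ym addr0.
- by rewrite -scalerA xm scaler0.
Qed.

Lemma annihilated_ideal_gen (M : lmodType R) A (m : M) :
  annihilated M A m -> annihilated M (ideal_gen A) m.
Proof. by move=> Am r /(_ _ (annihilator_left_ideal m)); apply. Qed.

Lemma annihilatedB (M : lmodType R) A (m m' : M) :
  annihilated M A m -> annihilated M A m' -> annihilated M A (m - m').
Proof. by move=> Am Am' r Ar; rewrite scalerBr Am ?Am' ?subr0. Qed.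

(** If every finite subfamily could be escaped by some [I b], adjoining such
    indices one after the other would give a chain of left ideals that never
    becomes stationary. *)
Lemma noetherian_finite_subfamily (L : Type) (I : L -> set R) :
  left_noetherian R ->
  exists2 F : set L, finite_set F &
    forall b, I b `<=` ideal_gen (\bigcup_(a in F) I a).
Proof.
move=> Rnoeth; apply: contrapT => noF.
have outside F : finite_set F ->
    exists b, ~ I b `<=` ideal_gen (\bigcup_(a in F) I a).
  by move=> Ffin; apply/existsNP => FI; apply: noF; exists F.
have [b0 _] := outside set0 (finite_set0 _).
have escape F : exists b, finite_set F ->
    ~ I b `<=` ideal_gen (\bigcup_(a in F) I a).
  have [/outside[b nI]|nF] := pselect (finite_set F); first by exists b.
  by exists b0.
have [next nextP] := choice escape.
pose F n := iter n (fun G => G `|` [set next G]) set0.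
have Ffin n : finite_set (F n).
  elim: n => [|n IHn]; first exact: finite_set0.
  by rewrite /= finite_setU; split=> //; exact: finite_set1.
have FS n : F n `<=` F n.+1 by move=> a Fa; left.
have [N /(_ N.+1 (leqnSn N)) stat] :=
  Rnoeth (fun n => ideal_gen (\bigcup_(a in F n) I a))
    (fun n => @ideal_gen_left_ideal _)
    (fun n => ideal_genS (bigcup_subset (FS n))).
apply: (nextP _ (Ffin N)); rewrite -stat => r Ir.
by apply: sub_ideal_gen; exists (next (F N)) => //; right.
Qed.

(** A common solution of finitely many congruences whose ideals generate all
    the others solves the whole system: it differs from a solution of these
    congruences and one more by an element killed by every ideal. *)
Lemma noetherian_semi_compact (M : lmodType R) :
  left_noetherian R -> semi_compact M.
Proof.
move=> Rnoeth L x I Iid finsol.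
have [F Ffin FI] := noetherian_finite_subfamily I Rnoeth.
have [m mP] := finsol F Ffin; exists m => b.
have [|m' m'P] := finsol (F `|` [set b]).
  by rewrite finite_setU; split=> //; exact: finite_set1.
have mm' : annihilated M (ideal_gen (\bigcup_(a in F) I a)) (m - m').
  apply: annihilated_ideal_gen => r [a Fa Iar].
  have := annihilatedB (mP a Fa) (m'P a (or_introl Fa)).
  by rewrite opprB addrA subrK; apply.
move=> r Ir; rewrite -(subrK m' m) -addrA scalerDr mm'; last exact: FI Ir.
by rewrite add0r; apply: m'P Ir; right.
Qed.

End GeneratedIdeal.

(** * Cokernels and direct sums *)

(** A module is finitely presented exactly when it is the cokernel of a map
    between finite free modules, so cokernels provide the finitely presented
    summands of the direct sum below. *)
Section Cokernel.
Variables (R : pzRingType) (U V : lmodType R) (f : {linear U -> V}).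

Definition image_pred : {pred V} := fun v => `[< range f v >].

Lemma image_pred_closed : submod_closed image_pred.
Proof.
split; first by apply/asboolP; exists 0; rewrite ?linear0.
move=> a u v /asboolP[x _ <-] /asboolP[y _ <-].
by apply/asboolP; exists (a *: x + y); rewrite ?linearP.
Qed.

HB.instance Definition _ := GRing.isSubmodClosed.Build R V image_pred
  image_pred_closed.

Definition coker : Type := Quotient.quot image_pred.

HB.instance Definition _ := GRing.Zmodule.on coker.

Definition to_coker (v : V) : coker := \pi_(Quotient.quot image_pred)%qT v.

Lemma to_coker_eq u v : to_coker u = to_coker v <-> range f (u - v).
Proof.
split=> [/eqP|uv]; last apply/eqP; rewrite /to_coker -Quotient.idealrBE.
  by move/asboolP.
by apply/asboolP.
Qed.

Lemma to_coker_surj (q : coker) : exists v, to_coker v = q.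
Proof. by exists (generic_quotient.repr q); exact: generic_quotient.reprK. Qed.

Definition coker_scale (a : R) (q : coker) : coker :=
  to_coker (a *: generic_quotient.repr (q : Quotient.quot image_pred)).

Lemma to_cokerD u v : to_coker (u + v) = to_coker u + to_coker v.
Proof. exact: Quotient.pi_add. Qed.

Lemma to_cokerZ a v : to_coker (a *: v) = coker_scale a (to_coker v).
Proof.
apply/to_coker_eq; rewrite -scalerBr.
have /to_coker_eq[x _ <-] : to_coker v =
    to_coker (generic_quotient.repr (to_coker v : Quotient.quot image_pred)).
  by rewrite /to_coker generic_quotient.reprK.
by exists (a *: x); rewrite ?linearZ.
Qed.

Fact coker_scaleA a b q :
  coker_scale a (coker_scale b q) = coker_scale (a * b) q.
Proof. by have [v <-] := to_coker_surj q; rewrite -!to_cokerZ scalerA. Qed.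

Fact coker_scale1 : left_id 1 coker_scale.
Proof.
by move=> q; have [v <-] := to_coker_surj q; rewrite -!to_cokerZ scale1r.
Qed.

Fact coker_scaleDr : right_distributive coker_scale +%R.
Proof.
move=> a p q; have [[u <-] [v <-]] := (to_coker_surj p, to_coker_surj q).
by rewrite -to_cokerD -!to_cokerZ scalerDr to_cokerD.
Qed.

Fact coker_scaleDl q : {morph coker_scale^~ q : a b / a + b}.
Proof.
move=> a b; have [v <-] := to_coker_surj q.
by rewrite -!to_cokerZ scalerDl to_cokerD.
Qed.

HB.instance Definition _ := GRing.Zmodule_isLmodule.Build R coker
  coker_scaleA coker_scale1 coker_scaleDr coker_scaleDl.

Fact to_coker_linear : linear to_coker.
Proof. by move=> a u v; rewrite to_cokerD to_cokerZ. Qed.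

HB.instance Definition _ := GRing.isLinear.Build R V coker *:%R to_coker
  to_coker_linear.

Lemma to_coker_eq0 v : to_coker v = 0 <-> range f v.
Proof. by rewrite -(linear0 to_coker) to_coker_eq subr0. Qed.

End Cokernel.

Lemma coker_finitely_presented (R : pzRingType) m n
  (f : {linear 'rV[R]_m -> 'rV[R]_n}) : finitely_presented (coker f).
Proof.
exists m, n, f, (to_coker f); split.
- by apply/seteqP; split=> v /to_coker_eq0.
- by rewrite -subTset => q _; have [v <-] := to_coker_surj q; exists v.
Qed.

Section DirectSum.
Variables (R : pzRingType) (M : nat -> lmodType R).

Definition dprod : Type := forall n, M n.

HB.instance Definition _ := Choice.on dprod.

Implicit Types u v w : dprod.

Let zero : dprod := fun=> 0.
Let opp u : dprod := fun n => - u n.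
Let add u v : dprod := fun n => u n + v n.
Let scale (a : R) u : dprod := fun n => a *: u n.

Fact dprod_addA : associative add.
Proof. by move=> u v w; apply: functional_extensionality_dep => n; exact: addrA. Qed.

Fact dprod_addC : commutative add.
Proof. by move=> u v; apply: functional_extensionality_dep => n; exact: addrC. Qed.

Fact dprod_add0 : left_id zero add.
Proof. by move=> u; apply: functional_extensionality_dep => n; exact: add0r. Qed.

Fact dprod_addN : left_inverse zero opp add.
Proof. by move=> u; apply: functional_extensionality_dep => n; exact: addNr. Qed.

HB.instance Definition _ := GRing.isZmodule.Build dprod
  dprod_addA dprod_addC dprod_add0 dprod_addN.

Fact dprod_scaleA a b u : scale a (scale b u) = scale (a * b) u.
Proof. by apply: functional_extensionality_dep => n; exact: scalerA. Qed.

Fact dprod_scale1 : left_id 1 scale.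
Proof. by move=> u; apply: functional_extensionality_dep => n; exact: scale1r. Qed.

Fact dprod_scaleDr : right_distributive scale +%R.
Proof. by move=> a u v; apply: functional_extensionality_dep => n; exact: scalerDr. Qed.

Fact dprod_scaleDl u : {morph scale^~ u : a b / a + b}.
Proof. by move=> a b; apply: functional_extensionality_dep => n; exact: scalerDl. Qed.

HB.instance Definition _ := GRing.Zmodule_isLmodule.Build R dprod
  dprod_scaleA dprod_scale1 dprod_scaleDr dprod_scaleDl.

Definition finsupp_pred : {pred dprod} :=
  fun u => `[< exists N, forall n, (N <= n)%N -> u n = 0 >].

Lemma finsupp_closed : submod_closed finsupp_pred.
Proof.
split; first by apply/asboolP; exists 0%N.
move=> a u v /asboolP[Nu uP] /asboolP[Nv vP]; apply/asboolP.
exists (maxn Nu Nv) => n; rewrite geq_max => /andP[Nun Nvn].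
have -> : (a *: u + v) n = a *: u n + v n by [].
by rewrite uP // vP // scaler0 addr0.
Qed.

HB.instance Definition _ := GRing.isSubmodClosed.Build R dprod finsupp_pred
  finsupp_closed.

Definition dsum : Type := {u : dprod | finsupp_pred u}.

HB.instance Definition _ := SubChoice.on dsum.
HB.instance Definition _ := [SubChoice_isSubLmodule of dsum by <:].

Definition dcoord n (u : dsum) : M n := val u n.

Fact dcoord_linear n : linear (dcoord n).
Proof. by []. Qed.

HB.instance Definition _ n := GRing.isLinear.Build R dsum (M n) *:%R (dcoord n)
  (dcoord_linear n).

Lemma dcoord_finsupp (u : dsum) :
  exists N, forall n, (N <= n)%N -> dcoord n u = 0.
Proof. by have /asboolP := valP u. Qed.

Lemma dsum_of_finsupp (f : dprod) N :
  (forall n, (N <= n)%N -> f n = 0) ->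
  exists u : dsum, forall n, dcoord n u = f n.
Proof.
move=> fN; have fP : finsupp_pred f by apply/asboolP; exists N.
by exists (exist _ f fP : dsum).
Qed.

Lemma dsum_ext (u v : dsum) : (forall n, dcoord n u = dcoord n v) -> u = v.
Proof. by move=> uv; apply/val_inj/functional_extensionality_dep. Qed.

Fact dinj_finsupp n (x : M n) : finsupp_pred (dfwith (0 : dprod) n x).
Proof.
apply/asboolP; exists n.+1 => k nk.
by rewrite dfwithout // neq_ltn nk.
Qed.

Definition dinj n (x : M n) : dsum := exist finsupp_pred _ (dinj_finsupp x).

Lemma dcoord_dinj n (x : M n) : dcoord n (dinj x) = x.
Proof. exact: dfwithin. Qed.

Lemma dcoord_dinj_neq n k (x : M n) : n != k -> dcoord k (dinj x) = 0.
Proof. by move=> nk; rewrite /dcoord /= dfwithout. Qed.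

Fact dinj_linear n : linear (@dinj n).
Proof.
move=> a x y; apply: dsum_ext => k; rewrite linearP /=.
have [<-|nk] := eqVneq n k; first by rewrite !dcoord_dinj.
by rewrite !(dcoord_dinj_neq _ nk) scaler0 addr0.
Qed.

HB.instance Definition _ n := GRing.isLinear.Build R (M n) dsum *:%R (@dinj n)
  (@dinj_linear n).

Lemma dsum_decomp N (u : dsum) : (forall n, (N <= n)%N -> dcoord n u = 0) ->
  u = \sum_(i < N) dinj (dcoord i u).
Proof.
move=> uN; apply: dsum_ext => n; rewrite linear_sum /=.
have [Nn|nN] := leqP N n.
  rewrite uN // big1 // => i _; rewrite dcoord_dinj_neq //.
  by rewrite neq_ltn (leq_trans (ltn_ord i) Nn).
rewrite (bigD1 (Ordinal nN)) //= dcoord_dinj big1 ?addr0 // => i ni.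
by rewrite dcoord_dinj_neq.
Qed.

End DirectSum.

Arguments dinj {R M} n x.

Lemma sum_ord_stationary (V : nmodType) (F : nat -> V) m n :
  (forall i, (m <= i)%N -> F i = 0) -> (m <= n)%N ->
  \sum_(i < n) F i = \sum_(i < m) F i.
Proof.
move=> F0 mn; rewrite -!(big_mkord xpredT) (big_cat_nat (n := m)) //=.
by rewrite [X in _ + X]big_nat_cond [X in _ + X]big1 ?addr0 // => i /andP[/andP[/F0]].
Qed.

(** Existence in the universal property of the direct sum; uniqueness is
    [dsum_hom_ext]. *)
Lemma dsum_hom (R : pzRingType) (M : nat -> lmodType R) (B : lmodType R)
    (k : forall n, {linear M n -> B}) :
  exists K : {linear dsum M -> B}, forall n x, K (dinj n x) = k n x.
Proof.
pose bound (u : dsum M) := projT1 (cid (dcoord_finsupp u)).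
have boundP u n : (bound u <= n)%N -> dcoord n u = 0.
  by rewrite /bound; case: cid => N /= uN; exact: uN.
pose K u := \sum_(i < bound u) k i (dcoord i u).
have KE u n : (bound u <= n)%N -> K u = \sum_(i < n) k i (dcoord i u).
  move=> un; apply/esym.
  apply: (sum_ord_stationary (F := fun i => k i (dcoord i u))) un => i ui.
  by rewrite boundP ?linear0.
(* The supports of the three vectors have different bounds, and the sums that
   define [K] can be compared once they run up to a common one. *)
have K_linear : linear K.
  move=> a u v; pose n := maxn (bound (a *: u + v)) (maxn (bound u) (bound v)).
  rewrite !(@KE _ n) ?leq_max ?leqnn ?orbT // scaler_sumr -big_split /=.
  by apply: eq_bigr => i _; rewrite !linearP.
pose KL : {linear dsum M -> B} :=
  HB.pack K (GRing.isLinear.Build R _ _ _ K K_linear).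
exists KL => n x; rewrite [LHS](@KE _ (maxn (bound (dinj n x)) n.+1)) ?leq_maxl //.
have lt_n : (n < maxn (bound (dinj n x)) n.+1)%N by rewrite leq_maxr.
rewrite (bigD1 (Ordinal lt_n)) //= dcoord_dinj big1 ?addr0 // => i ni.
by rewrite dcoord_dinj_neq ?linear0 // eq_sym.
Qed.

Lemma dsum_hom_ext (R : pzRingType) (M : nat -> lmodType R) (C : lmodType R)
    (g h : {linear dsum M -> C}) :
  (forall n x, g (dinj n x) = h (dinj n x)) -> g =1 h.
Proof.
move=> gh u; have [N uN] := dcoord_finsupp u; rewrite (dsum_decomp uN).
by rewrite !linear_sum; apply: eq_bigr => i _; exact: gh.
Qed.

Lemma finitely_presented_pure_projective (R : pzRingType) (F : lmodType R) :
  finitely_presented F -> pure_projective F.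
Proof. by move=> Ffp A B C f g [_]; apply. Qed.

(** A homomorphism out of a direct sum can be lifted one summand at a time,
    and the chosen lifts glue together. *)
Lemma dsum_pure_projective (R : pzRingType) (M : nat -> lmodType R) :
  (forall n, pure_projective (M n)) -> pure_projective (dsum M).
Proof.
move=> Mpp A B C f g fg h.
have lift n := cid (Mpp n A B C f g fg (h \o dinj n)).
have [K KE] := dsum_hom (fun n => projT1 (lift n)).
exists K => u; apply: (@dsum_hom_ext _ _ _ (g \o K)) => n x /=.
by rewrite KE; case: (lift n).
Qed.

(** * Semi-compactness of direct sums and ascending chains *)

(** The congruences x = x_n modulo the elements killed by the annihilator of
    [e n], where x_n = (e 0, ..., e (n-1), 0, ...), are finitely solvable: since
    the annihilators increase, x_p solves those of index at most [p]. In
    coordinate [N], a solution of the whole system agrees with [e N] up to an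
    element killed by the annihilators of all [e n] with n > N. Its support is
    finite, so for large [N] this element is [- e N] itself. *)
Lemma dsum_semi_compact_stationary (R : pzRingType) (M : nat -> lmodType R)
    (e : forall n, M n) :
  semi_compact (dsum M) ->
  (forall n r, r *: e n = 0 -> r *: e n.+1 = 0) ->
  exists N, forall n r, (N <= n)%N -> r *: e n = 0 -> r *: e N = 0.
Proof.
move=> Msc annS.
have ann_le m n r : (m <= n)%N -> r *: e m = 0 -> r *: e n = 0.
  move=> /subnK<- rm; elim: (n - m)%N => [//|d]; exact: annS.
have partial n : exists u : dsum M,
    forall k, dcoord k u = if (k < n)%N then e k else 0.
  apply: (@dsum_of_finsupp _ M (fun k => if (k < n)%N then e k else 0) n).
  by move=> k nk; rewrite ltnNge nk.
have [x xE] := choice partial.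
have [F /finite_seqP[s ->]|m mP] :=
  Msc nat x (fun n => [set r | r *: e n = 0])
    (fun n => annihilator_left_ideal (e n)).
  exists (x (\max_(i <- s) i)) => a /= sa r /= ra; apply: dsum_ext => k.
  rewrite linear0 linearZ linearB /= !xE.
  have a_le : (a <= \max_(i <- s) i)%N by apply: (@leq_bigmax_seq _ _ xpredT id).
  have [ka|ak] := ltnP k a; first by rewrite (leq_trans ka a_le) subrr scaler0.
  by case: ifP; rewrite subr0 ?scaler0 // (ann_le a).
have [N mN] := dcoord_finsupp m; exists N => n r Nn.
(* The congruence of index n.+1 is used because x_n vanishes at [N] if n = N. *)
move/annS/mP.
move/(congr1 (dcoord N)); rewrite linear0 linearZ linearB /= xE ltnS Nn mN //.
by rewrite sub0r scalerN => /eqP; rewrite oppr_eq0 => /eqP.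
Qed.

Section CyclicModules.
Variables (R : pzRingType) (a : nat -> R).

(** The cyclic module R/(R a_0 + ... + R a_(n-1)), with R seen as the row
    vectors of length 1 so that the module is visibly finitely presented. *)
Definition mod_span n : lmodType R :=
  coker (mulmxr (\col_(i < n) a i) : {linear 'rV[R]_n -> 'rV[R]_1}).

Definition gen n : mod_span n := to_coker _ (const_mx 1).

Lemma gen_annihilator n r :
  r *: gen n = 0 <-> ideal_gen (a @` `I_n) r.
Proof.
rewrite /gen -linearZ /= to_coker_eq0; split=> [[c _]|].
  move/matrixP/(_ 0 0); rewrite !mxE mulr1 => <- K [K0 KD KM] aK.
  elim/big_ind: _ => // i _; rewrite mxE; apply/KM/aK.
  by exists i => //=; exact: ltn_ord.
move/(_ [set s | range (mulmxr (\col_(i < n) a i)) (s *: const_mx 1)]).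
apply; last first.
  move=> _ [i /= ni <-]; exists (delta_mx 0 (Ordinal ni)) => //.
  by apply/matrixP => j k; rewrite /= -rowE !mxE mulr1.
split=> [|x y [c _ /= cx] [d _ /= dy]|x y [c _ /= cy]].
- by exists 0; rewrite //= mul0mx scale0r.
- by exists (c + d); rewrite //= mulmxDl cx dy scalerDl.
- by exists (x *: c); rewrite //= -scalemxAl cy scalerA.
Qed.

Lemma mod_span_finitely_presented n : finitely_presented (mod_span n).
Proof. exact: coker_finitely_presented. Qed.

End CyclicModules.

(** The element [a n] kills the generator of the summand of index n.+1, so once
    the annihilators are stationary it kills the one of index [n] too. *)
Lemma pure_projective_semi_compact_seq (R : pzRingType) (a : nat -> R) :
  (forall M : lmodType R, pure_projective M -> semi_compact M) ->
  exists n, ideal_gen (a @` `I_n) (a n).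
Proof.
move=> Rsc.
have [|n r|N NP] := @dsum_semi_compact_stationary R (mod_span a) (gen a).
- apply/Rsc/dsum_pure_projective => n.
  exact/finitely_presented_pure_projective/mod_span_finitely_presented.
- rewrite !gen_annihilator; apply: ideal_genS => _ [i /= ni <-].
  by exists i => //=; exact: ltnW.
exists N; apply/gen_annihilator/(NP N.+1) => //; apply/gen_annihilator.
by apply: sub_ideal_gen; exists N => /=.
Qed.

(** A chain that never becomes stationary yields a sequence in which every
    element lies outside an ideal of the chain that contains all the previous
    elements, so that it is not a combination of them. *)
Lemma left_noetherian_seq (R : pzRingType) :
  (forall a : nat -> R, exists n, ideal_gen (a @` `I_n) (a n)) ->
  left_noetherian R.
Proof.
move=> Rseq I Iid IS; apply: contrapT => /forallNP nstat.
have I_le m n : (m <= n)%N -> I m `<=` I n.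
  by move=> /subnK<- r rm; elim: (n - m)%N => [//|d /IS].
have escape m : exists nr : nat * R, I nr.1 nr.2 /\ ~ I m nr.2.
  have /existsNP[n /not_implyP[mn nI]] := nstat m.
  apply: contrapT => /forallNP noesc; apply: nI; apply/seteqP; split.
    by move=> r Inr; apply: contrapT => nImr; exact: (noesc (n, r)).
  exact: I_le.
have [pick pickP] := choice escape.
(* The maximum makes the indices increase along the iteration. *)
pose idx k := iter k (fun m => maxn m (pick m).1) 0%N.
have [n] := Rseq (fun k => (pick (idx k)).2).
move/(_ (I (idx n)) (Iid _)) => In; have [_ []] := pickP (idx n); apply: In.
move=> _ [k /= kn <-]; apply: (@I_le (idx k.+1)); last first.
  by apply: (I_le _ _ (leq_maxr _ _)); have [] := pickP (idx k).
rewrite -(subnK kn); elim: (n - k.+1)%N => [//|d IHd].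
by rewrite addSn (leq_trans IHd) // leq_maxl.
Qed.

Theorem theorem2p2 (R : pzRingType) :
  (forall M : lmodType R, pure_projective M -> semi_compact M) <->
  left_noetherian R.
Proof.
split=> [Rsc|Rnoeth M _]; last exact: noetherian_semi_compact.
by apply: left_noetherian_seq => a; exact: pure_projective_semi_compact_seq.
Qed.
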